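(* Let $(\Omega,\Sigma,\mu)$ be a finite measure space, let $Z$ be a real Banach space and let $X\subseteq Z^*$ be a norm-closed subspace which is norming for $Z$. Suppose that $(Z,\sigma(Z,X))$ has the Mazur property. If $\nu:\Sigma\to Z^*$ is a countably additive $\mu$-continuous vector measure such that $$\overline{\mathrm{co}(\mathcal{A}_\nu(A))}^{w^*}\cap X\neq\emptyset\quad\text{for every }A\in\Sigma\text{ with }\mu(A)>0,$$ then $\nu(\Sigma)\subseteq X$, i.e. $\nu(A)\in X$ for every $A\in\Sigma$.
   Context: A subspace $X\subseteq Z^*$ is norming for $Z$ if the formula $|||z|||=\sup\{\langle x,z\rangle: x\in B_X\}$ defines an equivalent norm on $Z$, where $B_X$ is the closed unit ball of $X$ and $\langle z^*,z\rangle$ denotes the evaluation of $z^*\in Z^*$ at $z\in Z$. $\sigma(Z,X)$ is the topology on $Z$ of pointwise convergence on $X$. A locally convex space $E$ has the Mazur property if every sequentially continuous linear functional $E\to\mathbb{R}$ is continuous. Countable additivity and $\mu$-continuity of $\nu$ are with respect to the norm of $Z^*$ ($\mu$-continuous: $\|\nu(A)\|\to 0$ as $\mu(A)\to 0$). For $A\in\Sigma$ with $\mu(A)>0$, the average range is $$\mathcal{A}_\nu(A):=\Big\{\frac{\nu(B)}{\mu(B)}: B\in\Sigma,\ B\subseteq A,\ \mu(B)>0\Big\}.$$ $\mathrm{co}$ denotes convex hull and $\overline{\,\cdot\,}^{w^*}$ denotes closure in $Z^*$ for the weak$^*$ topology $\sigma(Z^*,Z)$. *)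

(* Defs.v *)
From HB Require Import structures.
From mathcomp Require Import all_boot all_order all_algebra.
From mathcomp Require Import all_classical all_reals all_analysis.
From mathcomp Require Import ring.

Set Implicit Arguments.
Unset Strict Implicit.
Unset Printing Implicit Defensive.

Import Order.TTheory GRing.Theory Num.Theory.
Import numFieldNormedType.Exports.

Local Open Scope classical_set_scope.
Local Open Scope ring_scope.

Section dual_space.
Context {R : realType} (Z : normedModType R).

Definition continuous_linear_form : {pred Z -> R^o} :=
  fun f => `[< linear f /\ continuous f >].

Record dual := Dual {
  dual_fun :> Z -> R^o ;
  dualP : dual_fun \in continuous_linear_form }.

HB.instance Definition _ := [isSub for dual_fun].
HB.instance Definition _ := [Choice of dual by <:].

Lemma continuous_linear_form_submod_closed :
  submod_closed continuous_linear_form.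
Proof.
split.
  apply/asboolP; split; first by move=> a u v /=; rewrite scaler0 addr0.
  by move=> x; exact: cvg_cst.
move=> a f g /asboolP[fl fc] /asboolP[gl gc]; apply/asboolP; split.
  move=> b u v; rewrite !fctE fl gl.
  by rewrite !scalerDr !scalerA (mulrC a) addrACA.
move=> x; apply: (@cvgD _ R^o); last exact: gc.
by apply: (@cvgZl_tmp _ R^o); exact: fc.
Qed.

HB.instance Definition _ := GRing.isSubmodClosed.Build _ _
  continuous_linear_form continuous_linear_form_submod_closed.
HB.instance Definition _ := [SubChoice_isSubLmodule of dual by <:].

Lemma dual_linear (f : dual) : linear f.
Proof. by have /asboolP[] := dualP f. Qed.

Lemma dual_continuous (f : dual) : continuous f.
Proof. by have /asboolP[] := dualP f. Qed.

HB.instance Definition _ (f : dual) :=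
  GRing.isLinear.Build R Z R^o _ (dual_fun f) (dual_linear f).

Lemma dualDE (f g : dual) z : (f + g) z = f z + g z. Proof. by []. Qed.
Lemma dualZE (a : R) (f : dual) z : (a *: f) z = a * f z. Proof. by []. Qed.
Lemma dual0E z : (0 : dual) z = 0. Proof. by []. Qed.

Definition dual_norm (f : dual) : R :=
  sup [set `|f z| | z in [set z : Z | `|z| <= 1]].

Lemma dual_norm_has_sup (f : dual) :
  has_sup [set `|f z| | z in [set z : Z | `|z| <= 1]].
Proof.
split; first by exists `|f 0|; exists 0 => //=; rewrite normr0.
have /linear_bounded_continuous/linear_boundedP := @dual_continuous f.
move=> /pinfty_ex_gt0[M M0 fM]; exists M => _ [z /= z1 <-].
by rewrite (le_trans (fM z))// ler_piMr// ltW.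
Qed.

Lemma dual_norm_ge (f : dual) z : `|z| <= 1 -> `|f z| <= dual_norm f.
Proof.
by move=> z1; apply: sup_upper_bound; [exact: dual_norm_has_sup|exists z].
Qed.

Lemma dual_norm_le (f : dual) (M : R) :
  (forall z, `|z| <= 1 -> `|f z| <= M) -> dual_norm f <= M.
Proof.
move=> fM; apply: ge_sup; first exact: (dual_norm_has_sup f).1.
by move=> _ [z /= z1 <-]; exact: fM.
Qed.

Lemma ler_dual_normD (f g : dual) :
  dual_norm (f + g) <= dual_norm f + dual_norm g.
Proof.
apply: dual_norm_le => z z1.
by rewrite dualDE (le_trans (ler_normD _ _))// lerD// dual_norm_ge.
Qed.

Lemma dual_norm_ge0 (f : dual) : 0 <= dual_norm f.
Proof. by rewrite (le_trans _ (@dual_norm_ge f 0 _))// normr0. Qed.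

Lemma dual_normZ (a : R) (f : dual) : dual_norm (a *: f) = `|a| * dual_norm f.
Proof.
have le (b : R) (g : dual) : dual_norm (b *: g) <= `|b| * dual_norm g.
  apply: dual_norm_le => z z1.
  by rewrite dualZE normrM ler_wpM2l// dual_norm_ge.
apply/eqP; rewrite eq_le le/=.
have [->|a0] := eqVneq a 0; first by rewrite normr0 mul0r dual_norm_ge0.
rewrite -ler_pdivlMl ?normr_gt0// -normfV.
by rewrite (le_trans _ (le _ _))// scalerA mulVf// scale1r.
Qed.

Lemma dual_norm0_eq0 (f : dual) : dual_norm f = 0 -> f = 0.
Proof.
move=> f0; apply/val_inj/funext => z; change (f z = 0).
have [->|z0] := eqVneq z 0; first by rewrite linear0.
have /dual_norm_ge : `| `|z|^-1 *: z | <= 1.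
  by rewrite normrZ normfV normr_id mulVf// normr_eq0.
move=> /(_ f); rewrite f0 normr_le0 linearZ/= mulf_eq0 invr_eq0 normr_eq0.
by rewrite (negbTE z0)/= => /eqP.
Qed.

HB.instance Definition _ := Lmodule_isNormed.Build R dual
  ler_dual_normD dual_normZ dual_norm0_eq0.

End dual_space.

Section norming.
Context {R : realType}.

Definition is_norm (E : lmodType R) (N : E -> R) : Prop :=
  [/\ forall x y, N (x + y) <= N x + N y,
      forall (a : R) x, N (a *: x) = `|a| * N x
    & forall x, N x = 0 -> x = 0].

Definition equivalent_norm (E : normedModType R) (N : E -> R) : Prop :=
  is_norm N /\
  exists a b : R, [/\ 0 < a, 0 < b & forall x, a * `|x| <= N x <= b * `|x|].

Definition norming (Z : normedModType R) (X : set (dual Z)) : Prop :=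
  equivalent_norm
    (fun z : Z => sup [set x z | x in [set x | X x /\ `|x| <= 1]]).

End norming.

Section sigma_topologies.
Context {R : realType} (Z : normedModType R).

(* [weak_wrt X] is [Z] with the topology $\sigma(Z,X)$ and [weak_star] is
   [dual Z] with the topology $\sigma(Z^*,Z)$. Both are convertible to types
   that carry their own norm topology, so that points and functions have to be
   given the type [weak_wrt X] (resp. [weak_star]) explicitly. *)
Definition weak_wrt (X : set (dual Z)) : Type :=
  initial_topology ((fun z x => set_val x z) : Z -> {ptws set_type X -> R^o}).

Definition weak_star : Type :=
  initial_topology (@dual_fun R Z : dual Z -> {ptws Z -> R^o}).

HB.instance Definition _ := Topological.on weak_star.

Lemma weak_star_cvgP (F : set_system weak_star) (f : weak_star) : Filter F ->
  F --> f <->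
  forall z : Z, (fun g : weak_star => dual_fun g z : R^o) @ F --> dual_fun f z.
Proof.
move=> FF; pose h : dual Z -> {ptws Z -> R^o} := @dual_fun R Z.
split.
  move=> Ff z A /= zA; apply: Ff.
  have hc : continuous (h : weak_star -> {ptws Z -> R^o}).
    exact: initial_continuous.
  have pc : continuous (fun k : {ptws Z -> R^o} => k z).
    exact: (@proj_continuous _ (fun=> R^o) z).
  exact: (hc f _ (pc (h f) A zA)).
move=> Fz A [U [[/= V oV <-]] Vf VA]; apply: filterS VA _.
have : h @ F --> (h f : {ptws Z -> R^o}).
  apply/cvg_sup => z B [C [[D oD <-] Dz] DB].
  by apply: (filterS DB); apply: (Fz z); exact: open_nbhs_nbhs.
by apply; apply: open_nbhs_nbhs; split.
Qed.

Section weak_wrt_tvs.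
Variable X : set (dual Z).
Local Notation W := (weak_wrt X).

HB.instance Definition _ := Uniform.on W.
HB.instance Definition _ := GRing.Lmodule.copy W Z.

Lemma weak_wrt_cvgP (F : set_system W) (z : W) : Filter F ->
  F --> z <-> forall x : dual Z, X x -> (x : W -> R^o) @ F --> x z.
Proof.
move=> FF; pose g : Z -> {ptws set_type X -> R^o} := fun z x => set_val x z.
split.
  move=> Fz x Xx A /= xA; apply: Fz.
  have gc : continuous (g : W -> {ptws set_type X -> R^o}).
    exact: initial_continuous.
  have pc : continuous (fun h : {ptws set_type X -> R^o} => h (SigSub (mem_set Xx))).
    exact: (@proj_continuous _ (fun=> R^o) (SigSub (mem_set Xx))).
  exact: (gc z _ (pc (g z) A xA)).
move=> Fx A [U [[/= V oV <-]] Vz VA]; apply: filterS VA _.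
have : g @ F --> (g z : {ptws set_type X -> R^o}).
  apply/cvg_sup => x B [C [[D oD <-] Dx] DB].
  apply: (filterS DB); apply: (Fx (set_val x) (set_valP x)).
  exact: open_nbhs_nbhs.
by apply; apply: open_nbhs_nbhs; split.
Qed.

Lemma weak_wrt_form_continuous (x : dual Z) :
  X x -> continuous (x : W -> R^o).
Proof.
by move=> Xx z; exact: (weak_wrt_cvgP (F := nbhs z) z _).1 cvg_id x Xx.
Qed.

Let add_continuous : continuous (fun x : W * W => x.1 + x.2).
Proof.
move=> z; apply/weak_wrt_cvgP => x Xx.
rewrite linearD -fmap_comp (_ : _ \o _ = fun y : W * W => x y.1 + x y.2);
  last by apply/funext => y /=; rewrite linearD.
apply: (@cvgD _ R^o).
  by apply: (cvg_comp _ _ cvg_fst); exact: weak_wrt_form_continuous.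
by apply: (cvg_comp _ _ cvg_snd); exact: weak_wrt_form_continuous.
Qed.

Let scale_continuous : continuous (fun z : R^o * W => z.1 *: z.2).
Proof.
move=> z; apply/weak_wrt_cvgP => x Xx.
rewrite linearZ -fmap_comp (_ : _ \o _ = fun y : R^o * W => y.1 *: x y.2);
  last by apply/funext => y /=; rewrite linearZ.
apply: (@cvgZ _ R^o); first exact: cvg_fst.
by apply: (cvg_comp _ _ cvg_snd); exact: weak_wrt_form_continuous.
Qed.

Let locally_convex : exists2 B : set_system W,
  (forall b, b \in B -> convex_set b) & basis B.
Proof.
exists [set B | open B /\ convex_set B]; first by move=> b /[!inE] -[].
split; first by move=> B [].
move=> z; have FF : Filter (filter_from
    [set U : set W | (open U /\ convex_set U) /\ U z] id).
  apply: filter_from_filter.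
    by exists setT; split=> //; split; [exact: openT|move=> ? ? ?; rewrite !inE].
  move=> A B [[oA cA] Az] [[oB cB] Bz]; exists (A `&` B) => //.
  split; last by split.
  split; first exact: openI.
  move=> x y l /[!inE] -[Ax Bx] [Ay By]; split.
    by have := cA x y l; rewrite !inE; exact.
  by have := cB x y l; rewrite !inE; exact.
apply/weak_wrt_cvgP => x Xx A; rewrite -nbhs_ballE => -[e /= e0 eA].
exists ((x : W -> R^o) @^-1` (ball (x z : R^o) e)); last first.
  by move=> y /= xy; exact: eA.
split; last by rewrite /=; exact: ballxx.
split.
  apply: open_comp; last exact: ball_open.
  by move=> y _; exact: weak_wrt_form_continuous.
move=> u v l /[!inE]/= xu xv.
rewrite linearD !linearZ; move: xu xv; rewrite -!ball_normE /=.
have [t0 t1] : 0 <= l%:num /\ l%:num <= 1 by [].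
move: (l%:num) t0 t1 => t t0 t1; rewrite /unstable.onem /GRing.scale/=.
move: (x u) (x v) (x z) => a b c ca cb.
have -> : c - (t * a + (1 - t) * b) = t * (c - a) + (1 - t) * (c - b) by ring.
rewrite (le_lt_trans (ler_normD _ _))// !normrM.
have s0 : 0 <= 1 - t by rewrite subr_ge0.
rewrite (ger0_norm t0) (ger0_norm s0).
have [->|t_neq0] := eqVneq t 0; first by rewrite mul0r add0r subr0 mul1r.
rewrite [ltRHS](_ : e = t * e + (1 - t) * e); last by ring.
rewrite ltr_leD//; last by rewrite ler_wpM2l// ltW.
by rewrite ltr_pM2l// lt_neqAle eq_sym t_neq0.
Qed.

HB.instance Definition _ :=
  PreTopologicalNmodule_isTopologicalNmodule.Build W add_continuous.
HB.instance Definition _ :=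
  TopologicalNmodule_isTopologicalLmodule.Build R W scale_continuous.
HB.instance Definition _ := Uniform_isTvs.Build R W locally_convex.

End weak_wrt_tvs.
End sigma_topologies.

Definition mazur_property {R : realType} (E : tvsType R) : Prop :=
  forall f : {linear E -> R^o},
    (forall (u : nat -> E) (x : E), u @ \oo --> x -> f \o u @ \oo --> f x) ->
    continuous f.

Definition convex_hull {R : realType} {E : lmodType R} (A : set E) : set E :=
  smallest (@convex_set R E) A.

Section vector_measures.
Context {d : measure_display} {T : measurableType d} {R : realType}.
Context {V : normedModType R}.

(* Taking [F] constantly empty gives [nu set0 = 0], so that finite additivity
   is a special case. *)
Definition countably_additive (nu : set T -> V) : Prop :=
  forall F : nat -> set T, (forall n, measurable (F n)) -> trivIset setT F ->
    (\sum_(0 <= i < n) nu (F i)) @[n --> \oo] --> nu (\bigcup_n F n).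

Definition measure_continuous (mu : {finite_measure set T -> \bar R})
    (nu : set T -> V) : Prop :=
  forall e : R, 0 < e -> exists2 delta : R, 0 < delta &
    forall A, measurable A -> (mu A < delta%:E)%E -> `|nu A| < e.

Definition average_range (mu : {finite_measure set T -> \bar R})
    (nu : set T -> V) (A : set T) : set V :=
  [set (fine (mu B))^-1 *: nu B | B in
    [set B | [/\ measurable B, B `<=` A & (0 < mu B)%E]]].

End vector_measures.

(* Main.v *)
Require Import Defs.
From HB Require Import structures.
From mathcomp Require Import all_boot all_order all_algebra.
From mathcomp Require Import all_classical all_reals all_analysis.
From mathcomp Require Import measurable_realfun ring lra.
Import Order.TTheory GRing.Theory Num.Theory.
Import numFieldNormedType.Exports.

Set Implicit Arguments.
Unset Strict Implicit.
Unset Printing Implicit Defensive.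

Local Open Scope classical_set_scope.
Local Open Scope ring_scope.

(** Write f for the functional nu A on Z, where A is measurable.

    Reduction.  A functional that is continuous for sigma(Z,X) lies in X: it is
    small, hence zero, on a finite intersection of kernels of elements of X, so
    it is a linear combination of these elements ([weak_continuous_dual]).  By
    the Mazur property it is therefore enough that f is sequentially continuous
    for sigma(Z,X).  If it is not, there are y_k in Z and eps > 0 with
    x(y_k) -> 0 for all x in X and f(y_k) >= eps for all k.  The uniform
    boundedness principle on the Banach space X, together with the norming
    property, makes (y_k) norm bounded ([norming_bounded]).

    Contradiction ([bounded_weakly_null_not_separated]).  By the Radon-Nikodym
    theorem every z in Z has a density g_z of the scalar measure B |-> nu(B)(z).
    Passing from (y_k) to elements w_k of the closed convex hulls of its tails
    loses nothing: w_k is still bounded, still tends to 0 on X, and still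
    satisfies f(w_k) >= eps.  The gain is that the w_k can be chosen so that,
    outside a small set, all the densities g_k of the w_k are uniformly close to
    g_0 ([nearly_constant_densities]).  In place of weak compactness in L^1, the
    w_k almost minimise the strictly convex energy g |-> int sqrt(1+g^2)
    over the hulls: the midpoint of two almost minimisers is again a competitor,
    so strict convexity makes consecutive g_k close in measure, as closely as
    desired ([almost_minimizers], [truncated_dist_integral_le]).  The densities
    stay bounded in L^1 because nu has bounded range
    ([vector_measure_bounded], again by uniform boundedness).

    Now g_0 has integral at least eps over A, and nu is small on the small
    exceptional set where the g_k are not uniformly close to g_0.  So there are
    c > 0 and a set A' of positive measure on which g_k >= c for all k.  Every
    average nu(B)/mu(B) with B contained in A' then takes a value >= c at every
    w_k, and so does every point of the weak-star closed convex hull of the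
    average range over A'.  One of these points lies in X, where the values at
    w_k tend to 0: a contradiction. *)

(** * The dual is a Banach space *)

Section dual_complete.
Context {R : realType} {Z : normedModType R}.
Implicit Types (f g : dual Z) (z : Z).

Lemma normr_dualE f : `|f| = dual_norm f. Proof. by []. Qed.

Lemma dual_norm_bound f z : `|f z| <= `|f| * `|z|.
Proof.
have [->|z0] := eqVneq z 0; first by rewrite linear0 !normr0 mulr0.
have zp : 0 < `|z| by rewrite normr_gt0.
have := @dual_norm_ge _ _ f (`|z|^-1 *: z).
rewrite normrZ normfV normr_id mulVf ?gt_eqF// lexx => /(_ isT).
by rewrite linearZ/= normrM normfV normr_id ler_pdivrMl// mulrC.
Qed.

Lemma dual_norm_le_bound f (M : R) : 0 <= M ->
  (forall z, `|f z| <= M * `|z|) -> `|f| <= M.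
Proof.
move=> M0 fM; rewrite normr_dualE; apply: dual_norm_le => z z1.
by rewrite (le_trans (fM z))// ler_piMr.
Qed.

Lemma dual_of_bound (f : Z -> R^o) (M : R) : linear f ->
  (forall z, `|f z| <= M * `|z|) -> exists g : dual Z, forall z, g z = f z.
Proof.
move=> fl fM.
pose F : {linear Z -> R^o} := HB.pack f (GRing.isLinear.Build R Z R^o _ f fl).
have fc : continuous F.
  apply: (@bounded_linear_continuous _ _ R^o); apply/linear_boundedP.
  apply: filterS (nbhs_pinfty_ge (num_real M)) => r Mr z.
  by rewrite (le_trans (fM z))// ler_wpM2r.
suff h : f \in @continuous_linear_form R Z by exists (Dual h).
exact/asboolP.
Qed.

(** The limit is taken pointwise. A radius that is valid for the filter bounds
    the distance to the pointwise limit, which makes this limit bounded and the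
    convergence uniform on the unit ball. *)
Lemma dual_complete (F : set_system (dual Z)) :
  ProperFilter F -> cauchy F -> cvg F.
Proof.
move=> FF Fc; have /cauchyP Fb := Fc.
have ev (e : R) f : F (ball f e) -> forall z,
    F [set g : dual Z | `|f z - g z| <= e * `|z| ].
  move=> Ff z; apply: filterS Ff => g; rewrite -ball_normE /= => fg.
  rewrite -[f z - g z]/((f - g) z) (le_trans (dual_norm_bound _ _))//.
  by rewrite ler_wpM2r// ltW.
have evc z : cvg ((fun f : dual Z => f z : R^o) @ F).
  apply/cauchy_cvgP/cauchyP => e e0.
  have d0 : 0 < e / (`|z| + 1) by rewrite divr_gt0// ltr_wpDl.
  have [f Ff] := Fb _ d0.
  exists (f z); change (F [set g : dual Z | ball (f z : R^o) e (g z : R^o)]).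
  apply: filterS (ev _ _ Ff z) => g /= fg; rewrite -ball_normE /=.
  rewrite (le_lt_trans fg)// mulrAC ltr_pdivrMr ?ltr_wpDl//.
  by rewrite ltr_pM2l// ltrDl.
pose l z := lim ((fun f : dual Z => f z : R^o) @ F).
have lE z : (fun f : dual Z => f z : R^o) @ F --> l z by exact: evc.
have ll : linear (l : Z -> R^o).
  move=> a u v; rewrite [LHS]/l; apply: cvg_lim => //.
  rewrite (_ : (fun f : dual Z => _) = fun f : dual Z => a *: (f u : R^o) + f v).
    by apply: cvgD; [apply: cvgZl_tmp|]; exact: lE.
  by apply/funext => f; rewrite linearP.
have lev (e : R) f : F (ball f e) -> forall z, `|f z - l z| <= e * `|z|.
  move=> Ff z.
  have : (fun g : dual Z => `|f z - g z| : R^o) @ F --> `|f z - l z|.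
    by apply: cvg_norm; apply: cvgB; [exact: cvg_cst|exact: lE].
  by move/cvgr_to_le; apply; exact: ev.
have [f0 Ff0] := Fb _ ltr01.
have [g gE] : exists g : dual Z, forall z, g z = l z.
  apply: (@dual_of_bound l (1 + `|f0|)) => // z.
  rewrite (_ : l z = f0 z - (f0 z - l z)); last by rewrite subKr.
  rewrite (le_trans (ler_normB _ _))// mulrDl addrC lerD ?dual_norm_bound//.
  exact: lev.
apply/cvg_ex; exists g; apply/cvg_ballP => e e0.
have e40 : 0 < e / 4 by rewrite divr_gt0.
have [f Ff] := Fb _ e40.
apply: filterS (Ff) => h; rewrite -!ball_normE /= => fh.
have fg : `|f - g| <= e / 4.
  apply: dual_norm_le_bound; first exact: ltW.
  by move=> z; rewrite dualDE -/(- g) -[(- g) z]/(- g z) gE; exact: lev.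
rewrite -(subrKA f) (le_lt_trans (ler_normD _ _))// distrC; lra.
Qed.

HB.instance Definition _ := Uniform_isComplete.Build (dual Z) dual_complete.

End dual_complete.

(** * Uniform boundedness on a closed subspace *)

Section closed_subspace.
Context {R : realType} {E : completeNormedModType R} (X : set E).

(** A name for the membership predicate that carries the proof of closure, so
    that the algebraic structure of the subtype below is found from its type. *)
Definition subspace_pred (XS : submod_closed (mem X)) : {pred E} := mem X.

Section subtype.
Context (XS : submod_closed (mem X)) (XC : closed X).

(** The proofs are parameters of the type: the module, norm and completeness
    structures depend on them and are inferred from the type alone. *)
Record closed_sub (h : submod_closed (mem X)) (h' : closed X) := ClosedSub {
  closed_sub_val : E ;
  closed_subP : closed_sub_val \in subspace_pred h }.
Local Notation S := (closed_sub XS XC).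

HB.instance Definition _ := GRing.isSubmodClosed.Build _ _
  (subspace_pred XS) XS.
HB.instance Definition _ := [isSub for @closed_sub_val XS XC].
HB.instance Definition _ := [Choice of S by <:].
HB.instance Definition _ := [SubChoice_isSubLmodule of S by <:].

Let N (x : S) : R := `|val x|.
Let ND (x y : S) : N (x + y) <= N x + N y. Proof. exact: ler_normD. Qed.
Let NZ (a : R) (x : S) : N (a *: x) = `|a| * N x. Proof. exact: normrZ. Qed.
Let N0 (x : S) : N x = 0 -> x = 0.
Proof. by move=> /normr0_eq0 x0; exact: val_inj. Qed.

HB.instance Definition _ := Lmodule_isNormed.Build R S ND NZ N0.

Lemma closed_sub_complete (F : set_system S) :
  ProperFilter F -> cauchy F -> cvg F.
Proof.
move=> FF /cauchyP Fb.
have bE (x y : S) e : ball x e y <-> ball (val x) e (val y).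
  by rewrite -!ball_normE.
have : cvg ((val : S -> E) @ F).
  apply/cauchy_cvgP/cauchyP => e /Fb[x Fx]; exists (val x).
  change (F [set y : S | ball (val x) e (val y)]).
  by apply: filterS Fx => y; exact: (bE x y e).1.
move=> /cvg_ex[l Fl].
have Xl : X l.
  apply: (@closed_cvg _ _ _ _ val X XC _ l Fl).
  by apply: nearW => x; have := closed_subP x; rewrite inE.
apply/cvg_ex; exists (@ClosedSub XS XC l (mem_set Xl)).
apply/cvg_ballP => e e0; have /cvg_ballP/(_ e e0) := Fl.
apply: (@filterS _ F _ [set y : S | ball l e (val y)]) => y /= ly.
exact/bE.
Qed.

HB.instance Definition _ := Uniform_isComplete.Build S closed_sub_complete.

(** The Banach-Steinhaus theorem for functionals that are pointwise bounded on a
    closed subspace only, which is itself a Banach space. *)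
Lemma closed_subspace_uniform_boundedness (I : Type) (y : I -> dual E) :
  (forall x, X x -> exists M, forall i, `|y i x| <= M) ->
  exists M, forall i x, X x -> `|x| <= 1 -> `|y i x| <= M.
Proof.
move=> pb.
pose F := range (fun i => (fun x : S => y i (val x) : R^o)).
have [] := @Banach_Steinhauss R S R^o F _ _ 1.
- move=> _ [i _ <-]; split; last by move=> a u v; rewrite !linearP.
  move=> r; exists (`|y i| * r) => x xr.
  by rewrite (le_trans (dual_norm_bound _ _))// ler_wpM2l.
- move=> x; have [|M yM] := pb (val x).
    by have := closed_subP x; rewrite inE.
  by exists M => _ [i _ <-].
- move=> M FM; exists M => i x Xx x1.
  have Fi : F (fun x : S => y i (val x) : R^o) by exists i.
  exact: (FM _ Fi (@ClosedSub XS XC x (mem_set Xx)) x1).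
Qed.
End subtype.
End closed_subspace.

(** * Bounded sets and continuous functionals for the topology of X *)

Section norming_bound.
Context {R : realType} (Z : normedModType R) (X : set (dual Z)).

Lemma eval_bound (z : Z) : exists y : dual (dual Z), forall f, y f = f z.
Proof.
apply: (@dual_of_bound _ (dual Z) (fun f : dual Z => f z : R^o) `|z|).
  by [].
by move=> f; rewrite mulrC dual_norm_bound.
Qed.

(** A point of Z is a functional on X, and its norm as such is equivalent to its
    norm in Z because X is norming; so uniform boundedness on X applies. *)
Lemma norming_bounded (XS : submod_closed (mem X)) (XC : closed X) (I : Type)
    (y : I -> Z) : norming X ->
  (forall x, X x -> exists M, forall i, `|x (y i)| <= M) ->
  exists2 M, 0 < M & forall i, `|y i| <= M.
Proof.
move=> [_ [a [b [a0 b0 Xab]]]] pb.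
have [Y YE] := choice (fun i => eval_bound (y i)).
have [|M YM] := @closed_subspace_uniform_boundedness R (dual Z) X XS XC I Y.
  by move=> x /pb[M xM]; exists M => i; rewrite YE.
exists (Num.max 1 (M / a)); first by rewrite lt_max ltr01.
move=> i; rewrite le_max; apply/orP; right.
rewrite ler_pdivlMr// mulrC; have /andP[+ _] := Xab (y i); move/le_trans; apply.
apply: ge_sup.
  exists ((0 : dual Z) (y i)); exists 0 => //; split; last by rewrite normr0.
  by have := XS.1; rewrite inE.
move=> _ [x [Xx x1] <-]; rewrite (le_trans (ler_norm _))//.
by rewrite -YE; exact: YM.
Qed.

End norming_bound.

Section weak_dual.
Context {R : realType} (Z : normedModType R) (X : set (dual Z)).
Hypothesis XS : submod_closed (mem X).

(** A functional that vanishes on a finite intersection of kernels is a linear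
    combination of the functionals that define them. By induction: if x does
    not vanish on the intersection of the other kernels, subtracting the right
    multiple of x from f gives a functional that does. *)
Lemma finite_kernel_dual (s : seq (dual Z)) (f : dual Z) :
  (forall x, x \in s -> X x) ->
  (forall z, (forall x, x \in s -> x z = 0) -> f z = 0) -> X f.
Proof.
elim: s f => [f _ f0|x s IH f sX fs].
  suff -> : f = 0 by have := XS.1; rewrite inE.
  by apply/val_inj/funext => z; exact: f0.
have [x0|] := pselect (forall z, (forall x', x' \in s -> x' z = 0) -> x z = 0).
  apply: IH => [y ys|z zs]; first by apply: sX; rewrite inE ys orbT.
  by apply: fs => y; rewrite inE => /predU1P[->|/zs//]; exact: x0.
move=> /existsNP[z0 /not_implyP[z0s /eqP xz0]].
have Xx : X x by apply: sX; rewrite mem_head.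
pose a : R := f z0 / x z0.
suff : X (f - a *: x).
  move=> Xf; have := XS.2 a x (f - a *: x).
  by rewrite (addrC (a *: x)) subrK !inE => /(_ Xx Xf).
apply: IH => [y ys|z zs]; first by apply: sX; rewrite inE ys orbT.
have : f (z - (x z / x z0) *: z0) = 0.
  apply: fs => y; rewrite inE linearB linearZ/= /GRing.scale/=.
  move=> /predU1P[->|ys]; first by rewrite divfK// subrr.
  by rewrite (zs _ ys) (z0s _ ys) mulr0 subrr.
rewrite linearB linearZ/= => <-; change (f z - a * x z = f z - x z / x z0 * f z0).
by rewrite /a mulrAC [in RHS]mulrAC (mulrC (f z0)).
Qed.

(** The filter generated by the finite intersections of kernels of elements of X
    converges to 0 for sigma(Z,X). Hence a continuous functional is bounded by 1
    on such an intersection, and vanishes there by homogeneity. *)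
Lemma weak_continuous_dual (f : dual Z) :
  continuous (f : weak_wrt X -> R^o) -> X f.
Proof.
move=> fc.
pose K (s : seq (dual Z)) := [set z : weak_wrt X | forall x, x \in s -> x z = 0].
pose F := filter_from [set s : seq (dual Z) | forall x : dual Z, x \in s -> X x] K.
have FF : Filter F.
  apply: filter_from_filter; first by exists [::].
  move=> s t sX tX; exists (s ++ t).
    by move=> x; rewrite mem_cat => /orP[/sX|/tX].
  by move=> z st; split=> x xs; apply: st; rewrite mem_cat xs ?orbT.
have F0 : F --> (0 : weak_wrt X).
  apply/weak_wrt_cvgP => x Xx A /nbhs_singleton A0.
  exists [:: x] => [y|z xz] /=; first by rewrite inE => /eqP ->.
  by rewrite /= xz ?mem_head// -(linear0 x).
have /F0 : nbhs (0 : weak_wrt X) [set z : weak_wrt X | `|f z| < 1].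
  have H0 : (f : weak_wrt X -> R^o) @ (0 : weak_wrt X) --> (f 0 : R^o).
    exact: fc.
  apply: (@cvgr_norm_lt R R^o _ _ _ _ _ H0 1).
  by rewrite (linear0 f : f (0 : weak_wrt X) = 0) normr0.
move=> [s sX sf]; apply: (finite_kernel_dual sX) => z zs.
apply: contrapT => /eqP fz0.
have : `|f (2 *: ((f z)^-1 *: z))| < 1.
  by apply: sf => x xs /=; rewrite linearZ/= linearZ/= (zs _ xs) !scaler0.
rewrite linearZ/= linearZ/= /GRing.scale/= mulVf// mulr1 ger0_norm//.
by rewrite ltNge ler1n.
Qed.
End weak_dual.

(** * The strictly convex energy and its almost minimisers *)

Section energy.
Context {R : realType}.
Implicit Types x y : R.

(** Strictly convex with linear growth, so that its integral is finite on L^1. *)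
Definition phi x : R := Num.sqrt (1 + x ^+ 2).

Lemma sqr_phi x : phi x ^+ 2 = 1 + x ^+ 2.
Proof. by rewrite sqr_sqrtr// addr_ge0// sqr_ge0. Qed.

Lemma phi_ge0 x : 0 <= phi x. Proof. exact: sqrtr_ge0. Qed.

Lemma phi_le x : phi x <= 1 + `|x|.
Proof.
rewrite -(@ler_pXn2r _ 2)// ?nnegrE ?phi_ge0 ?addr_ge0// sqr_phi.
by rewrite sqrrD expr1n mul1r real_normK ?num_real// lerD2r lerDl mulrn_wge0.
Qed.

(** Quantitative strict convexity. With a = (1,x) and b = (1,y) in the Euclidean
    plane, the defect is |a| + |b| - |a + b|. Multiplied by |a| + |b| + |a + b|
    it is 2 (|a||b| - <a,b>), and multiplied again by |a||b| + <a,b> this gives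
    2 (x - y)^2, by the Lagrange identity. *)
Lemma phi_midpoint_defect x y :
  (x - y) ^+ 2 <= 4 * (1 + `|x| + `|y|) ^+ 3 *
    (phi x + phi y - 2 * phi ((x + y) / 2)).
Proof.
set S := 1 + `|x| + `|y|; set p := phi x; set q := phi y.
set r := 2 * phi ((x + y) / 2); set D := p + q - r.
have p0 : 0 <= p := phi_ge0 x; have q0 : 0 <= q := phi_ge0 y.
have r0 : 0 <= r by rewrite mulr_ge0// phi_ge0.
have pS : p <= S by rewrite (le_trans (phi_le x))// lerDl.
have qS : q <= S by rewrite (le_trans (phi_le y))// /S addrAC lerDl.
have p2 : p ^+ 2 = 1 + x ^+ 2 := sqr_phi x.
have q2 : q ^+ 2 = 1 + y ^+ 2 := sqr_phi y.
have r2 : r ^+ 2 = 4 + (x + y) ^+ 2.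
  by rewrite exprMn sqr_phi; field.
(* Lagrange identity *)
have cs : (p * q) ^+ 2 - (1 + x * y) ^+ 2 = (x - y) ^+ 2.
  by rewrite exprMn p2 q2; ring.
have pq0 : 0 <= p * q by rewrite mulr_ge0.
have : `|1 + x * y| <= `|p * q|.
  rewrite -ler_sqr ?nnegrE// !real_normK ?num_real//.
  by rewrite -subr_ge0 cs sqr_ge0.
rewrite (ger0_norm pq0) => pqxy.
have W0 : 0 <= p * q - (1 + x * y).
  by rewrite subr_ge0 (le_trans (ler_norm _)).
have DW : D * (p + q + r) = 2 * (p * q - (1 + x * y)).
  transitivity ((p + q) ^+ 2 - r ^+ 2); first by rewrite /D; ring.
  rewrite r2; transitivity (p ^+ 2 + q ^+ 2 + 2 * (p * q) - (4 + (x + y) ^+ 2)).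
    by ring.
  by rewrite p2 q2; ring.
have rpq : r <= p + q.
  rewrite -ler_sqr ?nnegrE ?addr_ge0// -subr_ge0.
  rewrite subr_sqr [X in 0 <= X](_ : _ = D * (p + q + r)); last by rewrite /D.
  by rewrite DW mulr_ge0.
have D0 : 0 <= D by rewrite subr_ge0.
have S0 : 0 <= S by rewrite !addr_ge0.
have -> : (x - y) ^+ 2 = (p * q - (1 + x * y)) * (p * q + (1 + x * y)).
  by rewrite -cs subr_sqr.
have le1 : p * q + (1 + x * y) <= 2 * S ^+ 2.
  rewrite [leRHS](_ : _ = S * S + S * S); last by ring.
  have pqS : p * q <= S * S by rewrite ler_pM.
  by rewrite lerD// (le_trans (ler_norm _))// (le_trans pqxy).
apply: (le_trans (ler_wpM2l W0 le1)).
rewrite mulrCA mulrA -DW.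
have le2 : D * (p + q + r) <= D * (4 * S) by rewrite ler_wpM2l//; lra.
apply: le_trans (ler_wpM2r (sqr_ge0 S) le2) _.
by rewrite le_eqVlt; apply/orP; left; apply/eqP; ring.
Qed.

(** The defect controls |x - y| only where x and y are not too large. Splitting
    according to whether t * min(|x - y|, 1) exceeds 1 + |x| + |y| turns this
    into a bound that is linear in |x|, |y| and the defect, and so can be
    integrated: the first term is small in L^1 for large t. *)
Lemma truncated_dist_le x y t : 0 < t ->
  Num.min `|x - y| 1 <= t^-1 * (1 + `|x| + `|y|) +
    4 * t ^+ 3 * (phi x + phi y - 2 * phi ((x + y) / 2)).
Proof.
move=> t0; have := phi_midpoint_defect x y.
set S := 1 + `|x| + `|y|; set D := phi x + _ - _ => xyD.
set u := Num.min _ _.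
have u1 : u <= 1 by rewrite ge_min lexx orbT.
have u0 : 0 <= u by rewrite le_min normr_ge0 ler01.
have S1 : 1 <= S by rewrite /S -addrA lerDl addr_ge0.
have S0 : 0 < S by rewrite (lt_le_trans ltr01).
have u2 : u ^+ 2 <= 4 * S ^+ 3 * D.
  apply: le_trans xyD; rewrite -(@real_normK _ (x - y)) ?num_real//.
  by rewrite ler_sqr ?nnegrE// ge_min lexx.
have D0 : 0 <= D.
  by move: (le_trans (sqr_ge0 u) u2); rewrite pmulr_rge0// mulr_gt0// exprn_gt0.
have [tuS|Stu] := leP (t * u) S.
  rewrite (@le_trans _ _ (t^-1 * S))//; first by rewrite ler_pdivlMl.
  by rewrite lerDl mulr_ge0// mulr_ge0// exprn_ge0// ltW.
rewrite (@le_trans _ _ (4 * t ^+ 3 * D))//; last first.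
  by rewrite lerDr mulr_ge0// ?invr_ge0 ltW.
have St : S <= t by rewrite (le_trans (ltW Stu))// ler_piMr// ltW.
rewrite -(ler_pM2r S0) (@le_trans _ _ (t * u ^+ 2))//.
  by rewrite expr2 mulrA mulrC ler_wpM2r// ltW.
rewrite (@le_trans _ _ (t * (4 * S ^+ 3 * D)))//; first by rewrite ler_wpM2l// ltW.
rewrite [leLHS](_ : _ = (4 * t * S * D) * S ^+ 2); last by ring.
rewrite [leRHS](_ : _ = (4 * t * S * D) * t ^+ 2); last by ring.
rewrite ler_wpM2l//; first by rewrite !mulr_ge0// ltW.
by rewrite ler_sqr ?nnegrE// ltW.
Qed.

Lemma measurable_phi : measurable_fun setT phi.
Proof.
apply: continuous_measurable_fun => x; rewrite /phi.
apply: (@continuous_comp _ _ _ (fun x : R => 1 + x ^+ 2) (@Num.sqrt R)).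
  by apply: cvgD; [exact: cvg_cst|exact: exprn_continuous].
exact: sqrt_continuous.
Qed.

End energy.

Section almost_minimizers.
Context {R : realType} (E : Type) (mid : E -> E -> E).

(** The infima of Phi over the decreasing sets K n increase to a finite limit A.
    Far enough in the sequence both the infimum and a suitable value of Phi are
    within eta / 4 of A, and the midpoint cannot be below the infimum. *)
Lemma almost_minimizers (K : nat -> set E) (Phi : E -> R) (M : R)
    (eta : nat -> R) :
  (forall n, K n !=set0) -> (forall m n, (m <= n)%N -> K n `<=` K m) ->
  (forall n v w, K n v -> K n w -> K n (mid v w)) ->
  (forall w, 0 <= Phi w) -> (forall w, K 0%N w -> Phi w <= M) ->
  (forall n, 0 < eta n) -> (forall n, eta n.+1 <= eta n) ->
  exists w : nat -> E, forall k, K k (w k) /\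
    Phi (w k) + Phi (w k.+1) - 2 * Phi (mid (w k) (w k.+1)) <= eta k.
Proof.
move=> K0 Kle Kmid Phi0 PhiM eta0 etale.
pose a n := inf (Phi @` K n).
have hinf n : has_inf (Phi @` K n).
  split; first by have [w Kw] := K0 n; exists (Phi w), w.
  by exists 0 => _ [w _ <-].
have aP n w : K n w -> a n <= Phi w.
  by move=> Kw; apply: ge_inf; [exact: (hinf n).2|exists w].
have hsup : has_sup (range a).
  split; first by exists (a 0%N), 0%N.
  exists M => _ [n _ <-]; have [w Kw] := K0 n.
  by rewrite (le_trans (aP _ _ Kw))// PhiM//; exact: Kle Kw.
pose A := sup (range a).
have aA n : a n <= A by apply: sup_upper_bound => //; exists n.
have aw k : exists w, exists2 n, (k <= n)%N &
    [/\ K n w, A - eta k / 4 <= a n & Phi w <= A + eta k / 4].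
  have e0 : 0 < eta k / 4 by rewrite divr_gt0.
  have [_ [n _ <-] An] := sup_adherent e0 hsup.
  pose m := maxn k n.
  have anm : a n <= a m.
    apply: lb_le_inf; first exact: (hinf m).1.
    by move=> _ [w Kw <-]; apply: aP; apply: Kle Kw; exact: leq_maxr.
  have [_ [w Kw <-] wm] := inf_adherent e0 (hinf m).
  exists w; exists m; first by rewrite leq_maxl.
  split => //; first by rewrite (le_trans _ anm)// ltW.
  by rewrite (le_trans (ltW wm))// lerD2r; exact: aA.
have [w /(_ _)/cid2-/all_sig2[n kn wn]] := choice aw.
exists w => k; have [Kw Aa wA] := wn k; have [Kw' Aa' wA'] := wn k.+1.
split; first exact: Kle Kw.
have : A - eta k / 4 <= Phi (mid (w k) (w k.+1)).
  have [le|/ltnW le] := leqP (n k) (n k.+1).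
    by rewrite (le_trans Aa)// aP//; apply: Kmid => //; exact: Kle Kw'.
  have ee := etale k.
  rewrite (@le_trans _ _ (A - eta k.+1 / 4))//; first lra.
  by rewrite (le_trans Aa')// aP//; apply: Kmid => //; exact: Kle Kw.
have := etale k; lra.
Qed.

End almost_minimizers.

(** * Almost uniform closeness from closeness in measure *)

Section finite_measure_integrals.
Context {d : measure_display} {T : measurableType d} {R : realType}.
Variable mu : {finite_measure set T -> \bar R}.
Implicit Types f g : T -> R.

Definition energy g : R := \int[mu]_x phi (g x).

Lemma integrable_cst_finite (r : R) : mu.-integrable setT (EFin \o cst r).
Proof. exact: finite_measure_integrable_cst. Qed.

Lemma integrable_measurable g : mu.-integrable setT (EFin \o g) ->
  measurable_fun setT g.
Proof. by move=> /measurable_int/measurable_EFinP. Qed.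

Lemma integrable_dominated f g : measurable_fun setT f ->
  mu.-integrable setT (EFin \o g) -> (forall x, `|f x| <= g x) ->
  mu.-integrable setT (EFin \o f).
Proof.
move=> mf ig fg; apply: le_integrable ig => //; first exact/measurable_EFinP.
by move=> x _ /=; rewrite lee_fin (le_trans (fg x))// ler_norm.
Qed.

Lemma integrableD_fun f g : mu.-integrable setT (EFin \o f) ->
  mu.-integrable setT (EFin \o g) ->
  mu.-integrable setT (EFin \o (fun x => f x + g x)).
Proof.
move=> i_f i_g.
by apply: eq_integrable (integrableD measurableT i_f i_g) => // x _ /=.
Qed.

Lemma integrableZ_fun (r : R) g : mu.-integrable setT (EFin \o g) ->
  mu.-integrable setT (EFin \o (fun x => r * g x)).
Proof.
move=> i_g.
by apply: eq_integrable (integrableZl measurableT r i_g) => // x _ /=.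
Qed.

Lemma integrable_norm_fun g : mu.-integrable setT (EFin \o g) ->
  mu.-integrable setT (EFin \o (fun x => `|g x|)).
Proof. by move=> /integrable_norm. Qed.

Lemma integrable_phi g : mu.-integrable setT (EFin \o g) ->
  mu.-integrable setT (EFin \o (fun x => phi (g x))).
Proof.
move=> ig; apply: (@integrable_dominated _ (fun x => 1 + `|g x|)).
- exact: measurableT_comp measurable_phi (integrable_measurable ig).
- by apply: integrableD_fun (integrable_cst_finite 1) (integrable_norm_fun ig).
- by move=> x; rewrite ger0_norm ?phi_ge0// phi_le.
Qed.

Lemma energy_le g : mu.-integrable setT (EFin \o g) ->
  energy g <= fine (mu setT) + \int[mu]_x `|g x|.
Proof.
move=> ig; have i1 := integrable_cst_finite 1.
have norm_ig := integrable_norm_fun ig.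
rewrite -[fine _]mul1r -Rintegral_cst// -RintegralD//.
apply: le_Rintegral => //; first exact: integrable_phi.
  exact: integrableD_fun.
by move=> x _; exact: phi_le.
Qed.

Lemma truncated_dist_integral_le f g (t : R) : 0 < t ->
  mu.-integrable setT (EFin \o f) -> mu.-integrable setT (EFin \o g) ->
  \int[mu]_x Num.min `|f x - g x| 1 <=
    t^-1 * (fine (mu setT) + \int[mu]_x `|f x| + \int[mu]_x `|g x|) +
    4 * t ^+ 3 *
      (energy f + energy g - 2 * energy (fun x => (f x + g x) / 2)).
Proof.
move=> t0 i_f i_g; have i1 := integrable_cst_finite 1.
have nf := integrable_norm_fun i_f; have ng := integrable_norm_fun i_g.
have im : mu.-integrable setT (EFin \o (fun x => (f x + g x) / 2)).
  apply: eq_integrable (integrableZ_fun 2^-1 (integrableD_fun i_f i_g)) => //.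
  by move=> x _ /=; rewrite mulrC.
have pf := integrable_phi i_f; have pg := integrable_phi i_g.
have pm := integrableZ_fun (-2) (integrable_phi im).
pose S x := t^-1 * (1 + `|f x| + `|g x|).
pose D x := 4 * t ^+ 3 * (phi (f x) + phi (g x) + -2 * phi ((f x + g x) / 2)).
have i1f := integrableD_fun i1 nf; have i1fg := integrableD_fun i1f ng.
have ifg := integrableD_fun pf pg; have ifgm := integrableD_fun ifg pm.
have iS : mu.-integrable setT (EFin \o S) by exact: integrableZ_fun.
have iD : mu.-integrable setT (EFin \o D) by exact: integrableZ_fun.
have -> : t^-1 * (fine (mu setT) + \int[mu]_x `|f x| + \int[mu]_x `|g x|) =
    \int[mu]_x S x.
  by rewrite RintegralZl// RintegralD// RintegralD// Rintegral_cst// mul1r.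
have -> : 4 * t ^+ 3 *
      (energy f + energy g - 2 * energy (fun x => (f x + g x) / 2)) =
    \int[mu]_x D x.
  rewrite RintegralZl// RintegralD// RintegralD// RintegralZl ?mulNr//.
  exact: integrable_phi.
rewrite -RintegralD//; apply: le_Rintegral => //.
- apply: (@integrable_dominated _ (cst 1)) => //.
    apply: measurable_minr => //; apply: measurableT_comp => //.
    by apply: measurable_funB; exact: integrable_measurable.
  move=> x; rewrite ger0_norm; first by rewrite ge_min lexx orbT.
  by rewrite le_min normr_ge0 ler01.
- exact: integrableD_fun.
- by move=> x _; rewrite /S /D mulNr; exact: truncated_dist_le.
Qed.

(** The truncated distances of consecutive terms have a sum h whose integral is at
    most c * delta, so that the set H where h >= c has measure at most delta.
    Where h < c <= 1 no truncation takes place, and h bounds the distance of the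
    first term to every other one. *)
Lemma nearly_constant_sequence (g : nat -> T -> R) (c delta : R) :
  0 < c -> c <= 1 -> 0 < delta ->
  (forall k, mu.-integrable setT (EFin \o g k)) ->
  (forall k, \int[mu]_x Num.min `|g k x - g k.+1 x| 1 <=
    c * delta / (2 ^ k.+1)%:R) ->
  exists H, [/\ measurable H, (mu H <= delta%:E)%E &
    forall k x, ~ H x -> `|g 0%N x - g k x| <= c].
Proof.
move=> c0 c1 delta0 ig gle.
pose u k x := Num.min `|g k x - g k.+1 x| 1.
have u0 k x : 0 <= u k x by rewrite le_min normr_ge0 ler01.
have mu_ k : measurable_fun setT (u k).
  apply: measurable_minr => //; apply: measurableT_comp => //.
  by apply: measurable_funB; exact: integrable_measurable.
have iu k : mu.-integrable setT (EFin \o u k).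
  apply: (@integrable_dominated _ (cst 1)) => //; first exact: integrable_cst_finite.
  by move=> x; rewrite ger0_norm// ge_min lexx orbT.
pose h x := (\sum_(k <oo) (u k x)%:E)%E.
have mh : measurable_fun setT h.
  apply: ge0_emeasurable_sum => // [k x _ _|k _]; first by rewrite lee_fin.
  exact/measurable_EFinP.
have h0 x : (0 <= h x)%E by apply: nneseries_ge0 => k _ _; rewrite lee_fin.
have hle : (\int[mu]_x h x <= (c * delta)%:E)%E.
  rewrite integral_nneseries//; first last.
  - by move=> k x _; rewrite lee_fin.
  - by move=> k; exact/measurable_EFinP.
  apply: le_trans (epsilon_trick0 xpredT _); last by rewrite mulr_ge0 ?ltW.
  apply: lee_nneseries => [k _ _|k _].
    by apply: integral_ge0 => x _; rewrite lee_fin.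
  have ufin : (\int[mu]_x (u k x)%:E)%E \is a fin_num.
    exact: (integrable_fin_num measurableT (iu k)).
  rewrite -(fineK ufin) lee_fin; exact: gle.
exists [set x | c%:E <= h x]%E; split.
- rewrite -[X in measurable X]setTI; exact: emeasurable_fun_c_infty.
- have := @le_integral_comp_abse _ _ _ mu _ measurableT h c id (@measurable_id _ _ setT).
  move=> /(_ (fun=> id) (fun _ _ _ _ => id) mh c0).
  rewrite setTI (_ : [set x | _] = [set x | c%:E <= h x]%E); last first.
    by apply/seteqP; split => x /=; rewrite gee0_abs.
  under eq_integral do rewrite gee0_abs//.
  move=> /le_trans/(_ hle); rewrite EFinM lee_pmul2l//.
- move=> k x /negP; rewrite -ltNge => hxc.
  have part n : (\sum_(0 <= k < n) (u k x)%:E < c%:E)%E.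
    apply: le_lt_trans hxc; apply: nneseries_lim_ge => m _ _.
    by rewrite lee_fin.
  have uE n : u n x = `|g n x - g n.+1 x|.
    rewrite /u /Num.min; case: ifPn => //; rewrite -leNgt => le1.
    have := part n.+1; rewrite big_nat_recr//= sumEFin -EFinD lte_fin.
    rewrite [u n x](_ : _ = 1).
      rewrite ltNge (le_trans c1)// lerDr sumr_ge0//.
    by rewrite /u /Num.min ltNge le1.
  apply/ltW; rewrite -lte_fin; apply: le_lt_trans (part k).
  rewrite sumEFin lee_fin; elim: k => [|k IH].
    by rewrite big_geq// subrr normr0.
  rewrite big_nat_recr//= uE (le_trans _ (lerD IH (lexx _)))//.
  by rewrite (le_trans _ (ler_normD _ _))// subrKA.
Qed.

End finite_measure_integrals.

(** * Scalar densities of the vector measure *)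

Section vector_measure.
Context {d : measure_display} {T : measurableType d} {R : realType}.
Variable mu : {finite_measure set T -> \bar R}.
Context {Z : completeNormedModType R}.
Variable nu : set T -> dual Z.
Hypothesis nu_additive : countably_additive nu.
Hypothesis nu_continuous : measure_continuous mu nu.

Definition density (z : Z) (g : T -> R) :=
  mu.-integrable setT (EFin \o g) /\
  forall B, measurable B -> \int[mu]_(x in B) g x = nu B z.

Lemma vector_measure_null A : measurable A -> mu A = 0%E -> nu A = 0.
Proof.
move=> mA A0; apply/eqP; rewrite -normr_le0; apply/ler_addgt0Pl => e e0.
have [delta delta0 nue] := nu_continuous e0.
by rewrite addr0 ltW// nue// A0 lte_fin.
Qed.

Lemma density_exists (z : Z) : exists g, density z g.
Proof.
pose f B : \bar R := (nu B z)%:E.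
have f0 : f set0 = 0%E by rewrite /f vector_measure_null.
have ffin B : measurable B -> f B \is a fin_num by [].
have fadd : semi_sigma_additive f.
  move=> F mF tF _; have [y yE] := eval_bound z.
  have /(@cvg_comp _ _ _ _ y _ _ _)/(_ (@dual_continuous _ _ y _)) := nu_additive mF tF.
  rewrite yE => ycvg; rewrite (_ : (fun n => _) =
      EFin \o (y \o (fun n => \sum_(0 <= i < n) nu (F i)))).
    exact: (cvg_comp _ _ ycvg).
  apply/funext => n /=; rewrite sumEFin linear_sum/=; congr EFin.
  by apply: eq_bigr => i _; rewrite yE.
pose F : {charge set T -> \bar R} := HB.pack f (isCharge.Build _ _ _ f f0 ffin fadd).
have Fmu : F `<< mu.
  apply/null_content_dominatesP => B mB B0.
  by rewrite /= /f vector_measure_null.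
have fin x := Radon_Nikodym_fin_num x Fmu.
have iRN := Radon_Nikodym_integrable Fmu.
have EF : EFin \o (fine \o Radon_Nikodym F mu) = Radon_Nikodym F mu.
  by apply/funext => x /=; rewrite fineK.
exists (fine \o Radon_Nikodym F mu); split; first by rewrite EF.
move=> B mB; rewrite /Rintegral.
by rewrite -[nu B z]/(fine (F B)) (Radon_Nikodym_integral Fmu mB) -EF.
Qed.

Lemma Rintegral_split (A P : set T) (g : T -> R) :
  measurable A -> measurable P -> mu.-integrable setT (EFin \o g) ->
  \int[mu]_(x in A) g x =
  \int[mu]_(x in A `&` P) g x + \int[mu]_(x in A `\` P) g x.
Proof.
move=> mA mP ig; rewrite -{1}(setUIDK A P) Rintegral_setU//.
- exact: measurableI.
- exact: measurableD.
- by rewrite setUIDK; apply: integrableS ig.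
- by apply/disj_setPS => x [[_ Px] [_]]; exact.
Qed.

Lemma density_norm_integral (z : Z) g (m : R) : density z g ->
  (forall B, measurable B -> `|nu B z| <= m) ->
  \int[mu]_x `|g x| <= 2 * m.
Proof.
move=> [ig gE] num.
pose P := [set x | 0 <= g x].
have mP : measurable P.
  rewrite -[P]setTI; apply: (@measurable_fun_le _ _ _ _ (cst 0)) => //.
  exact: integrable_measurable ig.
have mPC := measurableC mP; have norm_ig := integrable_norm_fun ig.
rewrite (Rintegral_split measurableT mP norm_ig) setTI setTD.
rewrite [X in X + _](_ : _ = nu P z); last first.
  rewrite -gE//; apply: eq_Rintegral => x; rewrite inE => gx.
  by rewrite ger0_norm.
rewrite [X in _ + X](_ : _ = - (nu (~` P) z : R)); last first.
  rewrite -gE// -mulN1r -RintegralZl//.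
    apply: eq_Rintegral => x; rewrite inE => /negP; rewrite -ltNge => gx.
    by rewrite mulN1r ltr0_norm.
  exact: integrableS ig.
rewrite [leRHS]mulrDl mul1r lerD//.
  by rewrite (le_trans _ (num _ mP))// ler_norm.
by rewrite (le_trans _ (num _ mPC))// -normrN ler_norm.
Qed.

(** For a fixed z the values nu(B)(z) are bounded by the L^1 norm of the density
    of z; uniform boundedness on Z makes the bound uniform on the unit ball. *)
Lemma vector_measure_bounded :
  exists2 M, 0 <= M & forall B, measurable B -> `|nu B| <= M.
Proof.
pose F := [set (nu B : Z -> R^o) | B in measurable].
have [] := @Banach_Steinhauss R Z R^o F _ _ 1.
- move=> _ [B mB <-]; split; last exact: dual_linear.
  move=> r; exists (`|nu B| * r) => z zr.
  by rewrite (le_trans (dual_norm_bound _ _))// ler_wpM2l.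
- move=> z; have [g [ig gE]] := density_exists z.
  exists (\int[mu]_x `|g x|) => _ [B mB <-]; rewrite -gE//.
  have iB : mu.-integrable B (EFin \o g) by exact: integrableS ig.
  rewrite (le_trans (le_normr_Rintegral mB iB))//.
  rewrite (Rintegral_split measurableT mB (integrable_norm_fun ig)) setTI.
  by rewrite lerDl Rintegral_ge0.
- move=> M FM; exists M.
    by rewrite (le_trans _ (FM (nu set0) _ 0 _)) ?normr0//; exists set0.
  move=> B mB; rewrite normr_dualE; apply: dual_norm_le => z z1.
  have FB : F (nu B) by exists B.
  exact: FM FB _ z1.
Qed.

End vector_measure.

(** * Half-spaces and average ranges *)

Section halfspace.
Context {R : realType} (Z : normedModType R).

Lemma weak_star_eval_continuous (z : Z) :
  continuous ((fun h : dual Z => h z : R^o) : weak_star Z -> R^o).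
Proof. by move=> f; exact: (weak_star_cvgP (F := nbhs f) f _).1 cvg_id z. Qed.

Lemma weak_star_closure_halfspace (S : set (dual Z)) (z : Z) (c : R) x :
  (forall h, S h -> c <= h z) ->
  closure (convex_hull S : set (weak_star Z)) x -> c <= (x : dual Z) z.
Proof.
move=> Sc.
pose D : set (weak_star Z) := [set h : weak_star Z | c <= (h : dual Z) z].
have cD : closed D.
  apply: (@closed_comp _ _ ((fun h : dual Z => h z : R^o) : weak_star Z -> R^o)
    [set r | c <= r]); last exact: closed_ge.
  by move=> h _; exact: weak_star_eval_continuous.
have HD : (convex_hull S : set (weak_star Z)) `<=` D.
  apply: smallest_sub => //.
  move=> f g l; rewrite !inE /D /= => fc gc.
  have [t0 t1] : 0 <= l%:num /\ l%:num <= 1 by [].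
  change (c <= l%:num * f z + (1 - l%:num) * g z).
  have -> : c = l%:num * c + (1 - l%:num) * c by ring.
  by rewrite lerD// ler_wpM2l// subr_ge0.
by move=> /(closure_subset HD); rewrite -(closure_id D).1.
Qed.

End halfspace.

(** * Densities along convex hulls of tails *)

Section densities_on_tails.
Context {d : measure_display} {T : measurableType d} {R : realType}.
Variable mu : {finite_measure set T -> \bar R}.
Context {Z : completeNormedModType R}.
Variable nu : set T -> dual Z.

Lemma average_range_ge (w : Z) g (c : R) (A : set T) : density mu nu w g ->
  measurable A -> (forall x, A x -> c <= g x) ->
  forall h, average_range mu nu A h -> c <= h w.
Proof.
move=> [ig gE] mA cg _ [B [mB BA B0] <-].
have mBfin : mu B \is a fin_num by rewrite fin_num_measure.
have fB0 : 0 < fine (mu B) by rewrite fine_gt0// B0/= ltey_eq mBfin.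
rewrite dualZE ler_pdivlMl// -gE// mulrC -Rintegral_cst//.
apply: le_Rintegral => //.
- exact: finite_measure_integrable_cst.
- exact: integrableS ig.
- by move=> x /BA; exact: cg.
Qed.

(** The closed convex hull of {y k | k >= n}, described by the half-spaces that
    contain it: every closed half-space that contains the tail contains w. *)
Definition closed_hull_tail (y : nat -> Z) (n : nat) : set Z :=
  [set w | forall (h : dual Z) (r : R),
    (forall k, (n <= k)%N -> h (y k) <= r) -> h w <= r].

Lemma closed_hull_tail_ge (y : nat -> Z) n w (h : dual Z) (r : R) :
  (forall k, (n <= k)%N -> r <= h (y k)) -> closed_hull_tail y n w -> r <= h w.
Proof.
move=> hr Kw; rewrite -lerN2; apply: (Kw (- h)) => k nk.
by change (- (h (y k)) <= - r); rewrite lerN2 hr.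
Qed.

Lemma closed_hull_tail_norm_le (y : nat -> Z) (C : R) n w (h : dual Z) :
  (forall k, `|y k| <= C) -> closed_hull_tail y n w -> `|h w| <= C * `|h|.
Proof.
move=> yC Kw.
have yh k : `|h (y k)| <= C * `|h|.
  by rewrite (le_trans (dual_norm_bound _ _))// mulrC ler_wpM2r.
rewrite ler_norml; apply/andP; split; last first.
  by apply: Kw => k _; rewrite (le_trans (ler_norm _)).
apply: closed_hull_tail_ge Kw => k _.
by have := yh k; rewrite ler_norml => /andP[].
Qed.

Hypothesis nu_additive : countably_additive nu.
Hypothesis nu_continuous : measure_continuous mu nu.

(** The set where g < 2 c outside H contributes at most 2 c mu(T) <= eps / 2 to
    nu A w, and A `&` H less than eps / 2; so the rest of A is not negligible. *)
Lemma density_large_on_positive_set (w : Z) g (c eps : R) (A H : set T) :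
  density mu nu w g -> measurable A -> measurable H -> 0 <= c ->
  2 * c * fine (mu setT) <= eps / 2 -> nu (A `&` H) w < eps / 2 ->
  eps <= nu A w -> (0 < mu ((A `\` H) `&` [set x | (2 * c <= g x)%R]))%E.
Proof.
move=> [ig gE] mA mH c0 cm nuAH nuA; set P := [set x | _].
have mP : measurable P.
  rewrite -[P]setTI; apply: (@measurable_fun_le _ _ _ _ (cst (2 * c))) => //.
  exact: integrable_measurable ig.
have mAH : measurable (A `\` H) by exact: measurableD.
have mAHP : measurable ((A `\` H) `&` P) by exact: measurableI.
rewrite lt0e measure_ge0 andbT; apply/eqP => muAHP.
move: nuA.
rewrite -gE// (Rintegral_split mA mH ig) (Rintegral_split mAH mP ig).
rewrite (gE _ (measurableI _ _ mA mH)) (gE _ mAHP).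
rewrite (vector_measure_null nu_continuous mAHP muAHP) dual0E add0r.
have : \int[mu]_(x in (A `\` H) `\` P) g x <= 2 * c * fine (mu setT).
  have mD : measurable ((A `\` H) `\` P) by exact: measurableD.
  rewrite (@le_trans _ _ (\int[mu]_(x in (A `\` H) `\` P) (2 * c)))//.
    apply: le_Rintegral => //; first exact: integrableS ig.
      exact: finite_measure_integrable_cst.
    by move=> x [_ /negP]; rewrite -ltNge => /ltW.
  rewrite Rintegral_cst// ler_wpM2l ?mulr_ge0//.
  by rewrite fine_le ?fin_num_measure// le_measure ?inE.
move=> b1 b2; have : eps < eps / 2 + eps / 2.
  by rewrite (le_lt_trans b2)// ltr_leD// (le_trans b1).
by rewrite -splitr ltxx.
Qed.

(** The energy is almost minimised over pairs of a point of the hull of a tail and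
    a density of that point: such pairs are stable under midpoints, although the
    density of a point is only unique almost everywhere. *)
Lemma nearly_constant_densities (y : nat -> Z) (C c delta : R) :
  0 < C -> (forall k, `|y k| <= C) -> 0 < c -> c <= 1 -> 0 < delta ->
  exists (w : nat -> Z) (g : nat -> T -> R) (H : set T),
    [/\ forall k, closed_hull_tail y k (w k),
        forall k, density mu nu (w k) (g k),
        measurable H, (mu H <= delta%:E)%E &
        forall k x, ~ H x -> `|g 0%N x - g k x| <= c].
Proof.
move=> C0 yC c0 c1 delta0.
have [M M0 nuM] := vector_measure_bounded nu_additive nu_continuous.
pose m := fine (mu setT).
have m0 : 0 <= m by exact: fine_ge0.
pose K n := [set p : Z * (T -> R) |
  closed_hull_tail y n p.1 /\ density mu nu p.1 p.2].
pose mid (p q : Z * (T -> R)) : Z * (T -> R) :=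
  (2^-1 *: (p.1 + q.1), fun x => (p.2 x + q.2 x) / 2).
have KL n p : K n p -> \int[mu]_x `|p.2 x| <= 2 * (C * M).
  move=> Kp; apply: density_norm_integral Kp.2 _ => B mB.
  rewrite (le_trans (closed_hull_tail_norm_le _ yC Kp.1))//.
  by rewrite ler_wpM2l ?nuM// ltW.
have Kint n p : K n p -> mu.-integrable setT (EFin \o p.2) by case=> _ [].
pose L := m + 2 * (C * M) + 2 * (C * M).
have L0 : 0 <= L by rewrite !addr_ge0// !mulr_ge0// ltW.
have L10 : 0 < L + 1 by rewrite ltr_wpDl.
pose theta k := c * delta / (2 ^ k.+1)%:R.
have theta0 k : 0 < theta k by rewrite divr_gt0 ?mulr_gt0// ltr0n expn_gt0.
have thetale k : theta k.+1 <= theta k.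
  rewrite ler_pM2l ?mulr_gt0// lef_pV2 ?posrE ?ltr0n ?expn_gt0//.
  by rewrite ler_nat leq_exp2l.
(* With t = 2 (L + 1) / theta k below, a defect of at most eta k makes both terms
   L / t and 4 t^3 (eta k) of the truncated distance at most theta k / 2. *)
pose eta k := theta k ^+ 4 / (64 * (L + 1) ^+ 3).
have [|||||||w wP] := @almost_minimizers R _ mid K
    (fun p => energy mu p.2) (m + 2 * (C * M)) eta _ _ _ _ _ _ _.
- move=> n; have [g gy] := density_exists nu_additive nu_continuous (y n).
  by exists (y n, g); split => //= h r; apply.
- by move=> i j ij p [Kp pd]; split => // h r hr; apply: Kp => k /(leq_trans ij); exact: hr.
- move=> n p q Kp Kq; split => /=.
    move=> h r hr; rewrite linearZ linearD/= /GRing.scale/=.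
    by have := Kp.1 h r hr; have := Kq.1 h r hr; lra.
  have [ip pE] := Kp.2; have [iq qE] := Kq.2.
  split.
    apply: eq_integrable (integrableZ_fun 2^-1 (integrableD_fun ip iq)) => //.
    by move=> x _ /=; rewrite mulrC.
  move=> B mB; rewrite linearZ linearD/= /GRing.scale/= -pE// -qE//.
  have ipB : mu.-integrable B (EFin \o p.2) by exact: integrableS ip.
  have iqB : mu.-integrable B (EFin \o q.2) by exact: integrableS iq.
  rewrite -RintegralD// mulrC -RintegralZr//.
  exact: integrableS (integrableD_fun ip iq).
- by move=> p; apply: Rintegral_ge0 => x _; exact: phi_ge0.
- move=> p Kp; rewrite (le_trans (energy_le (Kint _ _ Kp)))// lerD2l.
  exact: KL Kp.
- by move=> n; rewrite divr_gt0 ?exprn_gt0// mulr_gt0// exprn_gt0.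
- move=> n; rewrite ler_pM2r ?invr_gt0 ?mulr_gt0 ?exprn_gt0//.
  by rewrite lerXn2r ?nnegrE ?(ltW (theta0 _)).
have Kw k : K k (w k) by case: (wP k).
have [H [mH muH gH]] : exists H, [/\ measurable H, (mu H <= delta%:E)%E &
    forall k x, ~ H x -> `|(w 0%N).2 x - (w k).2 x| <= c].
  apply: nearly_constant_sequence => // k; first exact: Kint (Kw k).
  pose t := 2 * (L + 1) / theta k.
  have t0 : 0 < t by rewrite divr_gt0// mulr_gt0.
  apply: le_trans (truncated_dist_integral_le t0 (Kint _ _ (Kw k))
    (Kint _ _ (Kw k.+1))) _.
  rewrite -/(theta k) [theta k](splitr (theta k)) lerD//.
    rewrite (@le_trans _ _ (t^-1 * L))//.
      rewrite ler_wpM2l ?invr_ge0 ?(ltW t0)//.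
      apply: lerD; last exact: KL (Kw _).
      apply: lerD => //; exact: KL (Kw _).
    rewrite invf_div mulrAC ler_pdivrMr ?mulr_gt0//.
    rewrite [leRHS](_ : _ = theta k * (L + 1)); last by field.
    by rewrite ler_pM2l// lerDl.
  rewrite (@le_trans _ _ (4 * t ^+ 3 * eta k))//.
    apply: ler_wpM2l; last exact: (wP k).2.
    by rewrite mulr_ge0// exprn_ge0// ltW.
  rewrite le_eqVlt; apply/orP; left; apply/eqP; rewrite /t /eta.
  by field; rewrite !gt_eqF.
exists (fun k => (w k).1), (fun k => (w k).2), H.
by split => // k; have [] := Kw k.
Qed.

End densities_on_tails.

(** * Sequential continuity and the conclusion *)

Section weakly_null_sequences.
Context {d : measure_display} {T : measurableType d} {R : realType}.
Variable mu : {finite_measure set T -> \bar R}.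
Context {Z : completeNormedModType R}.
Variables (X : set (dual Z)) (nu : set T -> dual Z).
Hypothesis nu_additive : countably_additive nu.
Hypothesis nu_continuous : measure_continuous mu nu.
Hypothesis nu_average : forall A : set T, measurable A -> (0 < mu A)%E ->
  closure (convex_hull (average_range mu nu A) : set (weak_star Z))
    `&` X !=set0.

(** The heart of the proof: along a bounded sequence that tends to 0 on X, the
    functional nu A cannot stay away from 0, because otherwise some set of
    positive measure would violate the condition on average ranges. *)
Lemma bounded_weakly_null_not_separated (y : nat -> Z) (C : R) (A : set T)
    (eps : R) :
  0 < C -> (forall k, `|y k| <= C) ->
  (forall x : dual Z, X x -> x (y k) @[k --> \oo] --> (0 : R)) ->
  measurable A -> 0 < eps -> ~ (forall k, eps <= nu A (y k)).
Proof.
move=> C0 yC Xy mA eps0 epsy.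
pose m := fine (mu setT).
have m0 : 0 <= m by exact: fine_ge0.
have m10 : 0 < m + 1 by rewrite ltr_wpDl.
(* small enough for the set where the first density is below 2 c to contribute
   at most eps / 2 *)
pose c := Num.min 1 (eps / (4 * (m + 1))).
have c0 : 0 < c by rewrite lt_min ltr01 divr_gt0// mulr_gt0.
have c1 : c <= 1 by rewrite ge_min lexx.
have cm : 2 * c * m <= eps / 2.
  have : c <= eps / (4 * (m + 1)) by rewrite ge_min lexx orbT.
  rewrite ler_pdivlMr ?mulr_gt0// => cm; nra.
have e20 : 0 < eps / (2 * C) by rewrite divr_gt0// mulr_gt0.
have [delta delta0 nudelta] := nu_continuous e20.
have delta20 : 0 < delta / 2 by rewrite divr_gt0.
have [w [g [H [Kw wg mH muH gH]]]] :=
  nearly_constant_densities nu_additive nu_continuous C0 yC c0 c1 delta20.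
pose A' := (A `\` H) `&` [set x | 2 * c <= g 0%N x].
have mA' : measurable A'.
  apply: measurableI; first exact: measurableD.
  rewrite -[X in measurable X]setTI.
  apply: (@measurable_fun_le _ _ _ _ (cst (2 * c))) => //.
  exact: integrable_measurable (wg 0%N).1.
have A'0 : (0 < mu A')%E.
  apply: (density_large_on_positive_set nu_continuous (wg 0%N) mA mH (ltW c0) cm).
    rewrite (le_lt_trans (ler_norm _))//.
    rewrite (le_lt_trans (closed_hull_tail_norm_le _ yC (Kw 0%N)))//.
    rewrite -ltr_pdivlMl// (_ : C^-1 * _ = eps / (2 * C)); last first.
      by field; rewrite gt_eqF.
    apply: nudelta; first exact: measurableI.
    rewrite (@le_lt_trans _ _ (mu H))//.
      by rewrite le_measure ?inE//; exact: measurableI.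
    by rewrite (le_lt_trans muH)// lte_fin; lra.
  by apply: closed_hull_tail_ge (Kw 0%N) => k _.
have [x [clx Xx]] := nu_average mA' A'0.
have cx k : c <= (x : dual Z) (w k).
  apply: weak_star_closure_halfspace clx.
  apply: (average_range_ge (wg k) mA') => t [[_ nHt] /= gt].
  by have := gH k t nHt; rewrite ler_distl => /andP[_]; lra.
have /cvgr_lt/(_ (c / 2)) := Xy x Xx.
rewrite divr_gt0// => /(_ isT)[N _ xN].
have : (x : dual Z) (w N) <= c / 2 by apply: (Kw N) => k /xN/ltW.
by have := cx N; lra.
Qed.

End weakly_null_sequences.

Theorem theorem1 (R : realType)
    (d : measure_display) (Omega : measurableType d)
    (mu : {finite_measure set Omega -> \bar R})
    (Z : completeNormedModType R)
    (X : set (dual Z))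
    (X_subspace : submod_closed (mem X))
    (X_closed : closed X)
    (X_norming : norming X)
    (X_mazur : mazur_property (weak_wrt X))
    (nu : set Omega -> dual Z)
    (nu_additive : countably_additive nu)
    (nu_continuous : measure_continuous mu nu)
    (nu_average : forall A : set Omega, measurable A -> (0 < mu A)%E ->
      closure (convex_hull (average_range mu nu A) : set (weak_star Z))
        `&` X !=set0) :
  forall A : set Omega, measurable A -> X (nu A).
Proof.
move=> A mA; apply: weak_continuous_dual => //.
pose f : {linear weak_wrt X -> R^o} := (nu A : {linear Z -> R^o}).
apply: (X_mazur f) => u z uz.
have Xu x : X x -> (fun k => x (u k) : R^o) @ \oo --> (x z : R^o).
  move=> Xx; have /weak_wrt_cvgP := uz; exact.
apply: contrapT => nf.
have [e e0 gap] : exists2 e : R, 0 < e &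
    forall N, exists k, (N <= k)%N /\ e <= `|nu A (u k - z)|.
  apply: contrapT => /forall2NP H; apply: nf; apply/cvgrPdist_lt => e e0.
  have [//|/existsNP[N /forallNP HN]] := H e.
  exists N => // k /= Nk; have /not_andP[//|/negP] := HN k.
  rewrite -ltNge (_ : nu A (u k - z) = f (u k) - f z); last exact: linearB.
  by rewrite distrC; exact.
have [n nN] := choice gap.
(* The sign makes nu A positive along the sequence y. *)
pose v k : Z := (u (n k) : Z) - (z : Z).
pose y k : Z := Num.sg (nu A (v k)) *: v k.
have yE (h : dual Z) k : h (y k) = Num.sg (nu A (v k)) * (h (u (n k)) - h z).
  by rewrite linearZ /GRing.scale/=; congr (_ * _); exact: linearB.
have ny : forall k, e <= nu A (y k).
  move=> k; have [_] := nN k.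
  by rewrite linearZ/= /GRing.scale/= -normrEsg.
have Xy x : X x -> x (y k) @[k --> \oo] --> (0 : R).
  move=> Xx; apply/cvgrPdist_lt => r r0.
  have /cvgrPdist_lt/(_ r r0)[N _ xN] := Xu x Xx.
  exists N => // k /= Nk; rewrite sub0r normrN yE normrM.
  have {}xN := xN (n k) (leq_trans Nk (nN k).1).
  rewrite (le_lt_trans _ xN)// distrC ler_piMl//.
  by rewrite normr_sg; case: eqP.
have [x Xx|C C0 yC] := @norming_bounded R Z X X_subspace X_closed nat y X_norming.
  have [M [_ xM]] := cvg_seq_bounded (cvgP _ (Xy x Xx)).
  by exists (M + 1) => k; apply: xM => //; rewrite ltrDl.
exact: (bounded_weakly_null_not_separated nu_additive nu_continuous
  nu_average C0 yC Xy mA e0 ny).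
Qed.
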